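(* Let $n\geq 1$ and let $Q_n = K_2\times\cdots\times K_2$ ($n$ factors). Then $$ \left[ \sum_{T \in \mathrm{Tree}(Q_n)} q^{\mathrm{dir}(T)}\, x^{\mathrm{dd}(T)} \right]_{x^{(i)}_1 = x_i^{-1/2},\ x^{(i)}_2 = x_i^{1/2}\ (1\le i\le n)} = q_1 \cdots q_n \prod_{\substack{A \subseteq [n] \\ |A| \geq 2}} \left( \sum_{i \in A} q_i \left( x_i^{-1} + x_i \right)\right). $$
   Context: Notation: $[n]=\{1,2,\ldots,n\}$. $Q_n$ is the Cartesian product of $n$ copies of the complete graph $K_2$ on vertex set $\{1,2\}$, i.e. the $1$-skeleton of the $n$-dimensional cube: its vertices are the $n$-tuples $(j_1,\ldots,j_n)\in\{1,2\}^n$, with an edge joining two tuples exactly when they differ in exactly one coordinate. An edge lies in direction $i$ if its two endpoints differ in their $i$-th coordinate. $\mathrm{Tree}(Q_n)$ is the set of all spanning trees of $Q_n$. There are independent variables $q_1,\ldots,q_n$ and $x^{(i)}_1,x^{(i)}_2$ for $1\le i\le n$ (here $(i)$ is an upper index, not an exponent). For a spanning tree $T$ of $Q_n$, $$q^{\mathrm{dir}(T)}:=\prod_{i=1}^n q_i^{|\{\text{edges in } T \text{ in direction } i\}|},\qquad x^{\mathrm{dd}(T)} := \prod_{v=(j_1,\ldots,j_n)\in \{1,2\}^n} \left( x^{(1)}_{j_1} x^{(2)}_{j_2}\cdots x^{(n)}_{j_n}\right)^{\deg_T(v)},$$ where $\deg_T(v)$ is the degree of the vertex $v$ in $T$. The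 bracket with subscript means that the indicated substitution is made, where $x_1,\ldots,x_n$ are new independent variables with formal square roots $x_i^{1/2}$. *)

(* Defs.v *)
From mathcomp Require Import all_boot all_order all_algebra.
From mathcomp Require Import mpoly.

Set Implicit Arguments.
Unset Strict Implicit.
Unset Printing Implicit Defensive.

Import GRing.Theory.
Local Open Scope ring_scope.

(* A finite simple graph is a symmetric irreflexive relation on a finType;   *)
(* an edge is the two-element set of its endpoints.                          *)

Section Graphs.
Variable V : finType.

Definition edges (e : rel V) : {set {set V}} :=
  [set [set p.1; p.2] | p : V * V & e p.1 p.2].

Definition adj (T : {set {set V}}) : rel V :=
  [rel u v | (u != v) && ([set u; v] \in T)].

Definition is_connected (T : {set {set V}}) : bool :=
  [forall u, forall v, connect (adj T) u v].

(* A cycle is a cyclic sequence of at least 3 distinct vertices; its length  *)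
(* is at most #|V|, hence the bounded quantification (see is_acyclicP).      *)
Definition is_acyclic (T : {set {set V}}) : bool :=
  [forall k : 'I_#|V|.+1, forall c : k.-tuple V,
     ~~ [&& (2 < k)%N, cycle (adj T) c & uniq c]].

Lemma is_acyclicP (T : {set {set V}}) :
  reflect (forall c : seq V, (2 < size c)%N -> ~ ucycle (adj T) c)
          (is_acyclic T).
Proof.
apply: (iffP forallP) => [H c c2 /andP[cc uc] | H k].
- have hc : (size c < #|V|.+1)%N by rewrite ltnS -(card_uniqP uc) max_card.
  have /forallP/(_ (in_tuple c)) := H (Ordinal hc).
  by rewrite /= c2 cc uc.
- apply/forallP => c; apply/negP => /and3P[k2 cc uc].
  by apply: (H c); rewrite ?size_tuple // /ucycle cc.
Qed.

Definition is_spanning_tree (e : rel V) (T : {set {set V}}) : bool :=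
  [&& T \subset edges e, is_connected T & is_acyclic T].

Definition Tree (e : rel V) : {set {set {set V}}} :=
  [set T | is_spanning_tree e T].

Definition deg (T : {set {set V}}) (v : V) : nat := #|[set a in T | v \in a]|.

Definition complete_graph : rel V := [rel u v | u != v].

Definition cartesian_power (n : nat) (e : rel V) : rel {ffun 'I_n -> V} :=
  [rel u v : {ffun 'I_n -> V} |
     [exists i, e (u i) (v i) && [forall (j | j != i), u j == v j]]].

End Graphs.

Arguments complete_graph V : clear implicits.
Arguments cartesian_power {V} n e.

(* The vertex set {1,2} of K_2 is encoded as 'I_2, with the vertex 1 being   *)
(* 0 : 'I_2 and the vertex 2 being 1 : 'I_2.                                 *)
Notation cube_vertex n := {ffun 'I_n -> 'I_2}.

Definition Q (n : nat) : rel (cube_vertex n) :=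
  cartesian_power n (complete_graph 'I_2).

Arguments Q n : clear implicits.

Definition in_direction (n : nat) (i : 'I_n) (a : {set cube_vertex n}) : bool :=
  [exists u in a, exists v in a, u i != v i].

(* inl i indexes q_i, and inr (i, j) indexes x^(i)_j.                        *)
Definition cube_var (n : nat) : finType := ('I_n + 'I_n * 'I_2)%type.

Notation cube_poly n := {mpoly int[#|cube_var n|]}.

Definition pq (n : nat) (i : 'I_n) : cube_poly n :=
  'X_(enum_rank (inl i : cube_var n)).

Definition px (n : nat) (i : 'I_n) (j : 'I_2) : cube_poly n :=
  'X_(enum_rank (inr (i, j) : cube_var n)).

Definition q_dir (n : nat) (T : {set {set cube_vertex n}}) : cube_poly n :=
  \prod_(i < n) pq i ^+ #|[set a in T | in_direction i a]|.

Definition x_dd (n : nat) (T : {set {set cube_vertex n}}) : cube_poly n :=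
  \prod_(v : cube_vertex n) (\prod_(i < n) px i (v i)) ^+ deg T v.

(* The substitution takes values in the field of fractions of the polynomial *)
(* ring in independent variables q_i (indexed by inl i) and x_i^(1/2)        *)
(* (indexed by inr i); x_i is then the square of the latter.                 *)
Definition root_var (n : nat) : finType := ('I_n + 'I_n)%type.

Notation root_frac n := {fraction {mpoly int[#|root_var n|]}}.

Definition fq (n : nat) (i : 'I_n) : root_frac n :=
  FracField.tofrac 'X_(enum_rank (inl i : root_var n)).

Definition sqrt_x (n : nat) (i : 'I_n) : root_frac n :=
  FracField.tofrac 'X_(enum_rank (inr i : root_var n)).

Definition fx (n : nat) (i : 'I_n) : root_frac n := sqrt_x i ^+ 2.

Definition subst_val (n : nat) (w : cube_var n) : root_frac n :=
  match w with
  | inl i => fq i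
  | inr (i, j) => if j == 0 then (sqrt_x i)^-1 else sqrt_x i
  end.

Definition subst (n : nat) (p : cube_poly n) : root_frac n :=
  mmap (intr : int -> root_frac n) (fun k => subst_val (enum_val k)) p.

Lemma subst_pq n (i : 'I_n) : subst (pq i) = fq i.
Proof. by rewrite /subst /pq mmapX mmap1U enum_rankK. Qed.

Lemma subst_px1 n (i : 'I_n) : subst (px i 0) = (sqrt_x i)^-1.
Proof. by rewrite /subst /px mmapX mmap1U enum_rankK. Qed.

Lemma subst_px2 n (i : 'I_n) : subst (px i 1) = sqrt_x i.
Proof. by rewrite /subst /px mmapX mmap1U enum_rankK. Qed.

(* Main.v *)
Require Import Defs.
From mathcomp Require Import all_boot all_order all_algebra.
From mathcomp Require Import mpoly.
From mathcomp Require Import perm ring.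
Import GRing.Theory.
Local Open Scope ring_scope.

Set Implicit Arguments.
Unset Strict Implicit.
Unset Printing Implicit Defensive.

(** Give each edge of the cube the weight that the substitution attaches to
    it; the left-hand side is then the weighted number of spanning trees, and
    the proof evaluates it as a determinant.

    The link is a weighted matrix-tree theorem: the determinant of the
    Laplacian with [1] added at one diagonal entry [r] is the sum over spanning
    trees of the product of the edge weights ([weighted_matrix_tree]).  Every
    row of this matrix is a combination of simple rows, one for each possible
    image of the vertex, so by multilinearity the determinant is a sum over
    maps [f] from the vertices to themselves ([det_laplacian_forests]).  The
    determinant attached to [f] is [1] if all orbits of [f] end in a fixed
    point and [0] otherwise, and only the maps with fixed point [r] alone
    survive: these are the parent maps of the spanning trees rooted at [r]
    ([sum_trees_parent_maps]).  As the rows and columns of the Laplacian [L]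
    sum to zero, the tree sum [tau] also satisfies
    [det (L + a b^T) = (sum a) (sum b) tau] ([det_laplacian_rank1]).

    For the cube, a vertex [v] gets the weight [X_v], a product of factors
    [x_i^(1/2)] or [x_i^(-1/2)], and the edge [{u, v}] in direction [i] gets
    [q_i X_u X_v].  The factors at [i] cancel in this product, while the other
    ones are squared, hence the Laplacian is a sum over [i] of tensor products
    in which only factor [i] is not diagonal.  Each factor has two explicit
    eigenvectors, orthogonal for the weights [X^2]; their tensor products,
    indexed by subsets [A] of the directions, diagonalize
    [L + a a^T], where [a_v = X_v^2] ([laplacian_eigtensor],
    [eigtensor_orth]).  With [c_i = x_i^(-1) + x_i] and [C = prod_i c_i], the
    diagonal entries are [C] times [sum_(i in A) q_i c_i] for nonempty [A], and
    [C^2] for empty [A].  Since [prod_v X_v^2 = 1], the change of basis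
    accounts exactly for one factor [C] in each entry, and
    [det (L + a a^T) = C prod_(A nonempty) sum_(i in A) q_i c_i].  On the other
    hand the entries of [a] sum to [C], so this determinant is [C^2 tau].  The
    singletons [A] contribute [C prod_i q_i], and cancelling [C^2] gives the
    formula. *)

(** * Matrices indexed by a finite type *)

Section IndexedMatrix.
Variables (R : comNzRingType) (V : finType).
Implicit Types (F G : V -> V -> R) (a b : V -> R).

Definition fin_mx F : 'M[R]_#|V| :=
  \matrix_(i, j) F (enum_val i) (enum_val j).

Lemma sum_enum_val a : \sum_(i < #|V|) a (enum_val i) = \sum_v a v.
Proof. by rewrite [RHS](reindex _ (onW_bij _ (@enum_val_bij V))). Qed.

Lemma prod_enum_val a : \prod_(i < #|V|) a (enum_val i) = \prod_v a v.
Proof. by rewrite [RHS](reindex _ (onW_bij _ (@enum_val_bij V))). Qed.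

Lemma eq_fin_mx F G : F =2 G -> fin_mx F = fin_mx G.
Proof. by move=> FG; apply/matrixP => i j; rewrite !mxE FG. Qed.

Lemma fin_mxM F G : fin_mx F *m fin_mx G = fin_mx (fun u v => \sum_z F u z * G z v).
Proof.
apply/matrixP => i j; rewrite !mxE -[RHS]sum_enum_val.
by apply: eq_bigr => k _; rewrite !mxE.
Qed.

Lemma det_fin_mx_tr F : \det (fin_mx (fun u v => F v u)) = \det (fin_mx F).
Proof. by rewrite -[RHS]det_tr; congr (\det _); apply/matrixP=> i j; rewrite !mxE. Qed.

Lemma det_fin_mx_diag a : \det (fin_mx (fun u v => (u == v)%:R * a u)) = \prod_v a v.
Proof.
rewrite -prod_enum_val (_ : fin_mx _ = diag_mx (\row_i a (enum_val i))).
  by rewrite det_diag; apply: eq_bigr => i _; rewrite mxE.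
apply/matrixP => i j; rewrite !mxE (inj_eq enum_val_inj) mulr_natl.
by case: eqVneq => [->|].
Qed.

(** Two block factorizations of the same bordered matrix: the case of
    rank one of Sylvester's determinant identity. *)
Lemma det_fin_mx_1D_rank1 a b :
  \det (fin_mx (fun u v => (u == v)%:R + a u * b v)) = 1 + \sum_v a v * b v.
Proof.
pose A : 'cV[R]_#|V| := \col_i a (enum_val i).
pose B : 'rV[R]_#|V| := \row_i b (enum_val i).
have -> : fin_mx (fun u v => (u == v)%:R + a u * b v) = 1%:M + A *m B.
  apply/matrixP => i j.
  by rewrite !mxE big_ord1 !mxE (inj_eq enum_val_inj).
have BA : \det (1%:M + B *m A) = 1 + \sum_v a v * b v.
  rewrite det_mx11 !mxE -sum_enum_val; congr (_ + _).
  by apply: eq_bigr => i _; rewrite !mxE mulrC.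
have E1 : block_mx 1%:M B (- A) 1%:M
    = block_mx 1%:M 0 (- A) 1%:M *m block_mx 1%:M B 0 (1%:M + A *m B).
  by rewrite mulmx_block !(mul1mx, mul0mx, mulmx1, mulmx0, addr0, mulNmx)
     addrCA addNr addr0.
have E2 : block_mx 1%:M B (- A) 1%:M
    = block_mx (1%:M + B *m A) B 0 1%:M *m block_mx 1%:M 0 (- A) 1%:M.
  by rewrite mulmx_block !(mul1mx, mul0mx, mulmx1, mulmx0, addr0, add0r, mulmxN, addrK).
rewrite -BA; have := congr1 determinant E2.
by rewrite E1 !det_mulmx !det_lblock !det_ublock !det1 !mul1r !mulr1.
Qed.

(** Multiplying by the adjugate avoids any division: an entry [1] in a kernel
    vector is enough over a commutative ring. *)
Lemma det_fin_mx_ker F a v0 :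
  a v0 = 1 -> (forall u, \sum_v F u v * a v = 0) -> \det (fin_mx F) = 0.
Proof.
move=> av0 Fa0; pose A : 'cV[R]_#|V| := \col_i a (enum_val i).
have FA : fin_mx F *m A = 0.
  apply/matrixP => i j; rewrite !mxE -[RHS](Fa0 (enum_val i)) -sum_enum_val.
  by apply: eq_bigr => k _; rewrite !mxE.
have : \adj (fin_mx F) *m (fin_mx F *m A) = 0 by rewrite FA mulmx0.
rewrite mulmxA mul_adj_mx mul_scalar_mx => /matrixP/(_ (enum_rank v0) 0).
by rewrite !mxE enum_rankK av0 mulr1.
Qed.

(** Multilinearity of the determinant in its rows, when each row is given as a
    linear combination with coefficients indexed by [V] itself: choosing one
    term in each row is choosing a map from [V] to [V]. *)
Lemma det_fin_mx_rows (c : V -> V -> R) (G : V -> V -> V -> R) :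
  \det (fin_mx (fun u v => \sum_z c u z * G u z v)) =
  \sum_(f : {ffun V -> V})
     (\prod_v c v (f v)) * \det (fin_mx (fun u v => G u (f u) v)).
Proof.
transitivity (\sum_(g : {ffun 'I_#|V| -> V}) \prod_i c (enum_val i) (g i)
   * \det (\matrix_(i, j) G (enum_val i) (g i) (enum_val j))); last first.
  pose h (f : {ffun V -> V}) : {ffun 'I_#|V| -> V} :=
    [ffun i : 'I_#|V| => f (enum_val i)].
  pose k (g : {ffun 'I_#|V| -> V}) : {ffun V -> V} := [ffun v : V => g (enum_rank v)].
  have hk : cancel h k by move=> f; apply/ffunP => v; rewrite !ffunE enum_rankK.
  have kh : cancel k h by move=> f; apply/ffunP => v; rewrite !ffunE enum_valK.
  rewrite (reindex h); last by apply: onW_bij; exists k.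
  apply: eq_bigr => f _ /=; congr (_ * _).
    by rewrite -prod_enum_val; apply: eq_bigr => i _; rewrite ffunE.
  by congr (\det _); apply/matrixP => i j; rewrite !mxE ffunE.
rewrite {1}/determinant.
under eq_bigr => s _.
  under eq_bigr => i _ do rewrite mxE.
  rewrite bigA_distr_bigA big_distrr /=; over.
rewrite exchange_big; apply: eq_bigr => g _ /=.
rewrite /determinant big_distrr; apply: eq_bigr => s _ /=.
rewrite big_split /= mulrCA; congr (_ * (_ * _)).
by apply: eq_bigr => i _; rewrite mxE.
Qed.

End IndexedMatrix.

(** * The forest expansion of a Laplacian determinant *)

Section Forest.
Variables (R : comNzRingType) (V : finType).

Definition laplacian (w : V -> V -> R) (u v : V) : R :=
  (u == v)%:R * (\sum_z w u z) - w u v.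

Definition reaches_fixpoint (f : V -> V) (v : V) : bool :=
  [exists x, fconnect f v x && (f x == x)].

Definition rooted (f : V -> V) : bool := [forall v, reaches_fixpoint f v].

Lemma reaches_fixpointP f v :
  reflect (exists k, f (iter k f v) = iter k f v) (reaches_fixpoint f v).
Proof.
apply: (iffP existsP) => [[x /andP[vx /eqP fx]]|[k fk]].
  by exists (findex f v x); rewrite iter_findex.
by exists (iter k f v); rewrite fconnect_iter fk eqxx.
Qed.

Lemma reaches_fixpoint_step f v : reaches_fixpoint f (f v) = reaches_fixpoint f v.
Proof.
apply/reaches_fixpointP/reaches_fixpointP => -[k fk].
  by exists k.+1; rewrite iterSr.
by exists k; rewrite -iterSr /= fk.
Qed.

(** The Laplacian of the functional digraph of [f], where a fixed point has a
    row of the identity instead of a zero row. *)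
Definition map_laplacian (f : V -> V) (u v : V) : R :=
  (u == v)%:R - ((f u != u) && (f u == v))%:R.

(** A permutation contributing to the Leibniz expansion agrees with [f] at
    every point it moves, so a moved point has only moved iterates under [f]
    and never arrives at a fixed point: only the identity contributes. *)
Lemma det_map_laplacian_rooted f :
  rooted f -> \det (fin_mx (map_laplacian f)) = 1.
Proof.
move=> /forallP rf; rewrite /determinant (bigD1 (1%g : {perm 'I_#|V|})) //=.
rewrite [X in _ + X]big1 => [|s s1].
  rewrite odd_perm1 mul1r addr0 big1 // => i _.
  rewrite mxE perm1 /map_laplacian eqxx; case: eqVneq; rewrite ?subr0 //.
rewrite -[RHS](mulr0 ((-1) ^+ s)); congr (_ * _); apply/eqP.
apply: contraR s1 => nz; apply/eqP/permP => i; rewrite perm1.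
apply/eqP/negP => /negP si.
have mv j : s j != j -> enum_val (s j) = f (enum_val j).
  move=> sj; apply/eqP; apply: contraR nz => nf; rewrite (bigD1 j) //= mxE.
  rewrite /map_laplacian (inj_eq enum_val_inj) [j == _]eq_sym (negbTE sj).
  by rewrite [f _ == enum_val (s j)]eq_sym (negbTE nf) andbF subr0 mul0r.
have it k : s (iter k s i) != iter k s i
    /\ enum_val (iter k s i) = iter k f (enum_val i).
  elim: k => [//|k [IH1 IH2]]; split; first by rewrite /= (inj_eq perm_inj).
  by rewrite /= mv // IH2.
have /reaches_fixpointP[k fk] := rf (enum_val i).
have [/negP[]] := it k; apply/eqP/enum_val_inj.
by have [_ /= ->] := it k.+1; rewrite fk; have [_ ->] := it k.
Qed.

(** The points from which no fixed point is reached form a set stable under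
    images and preimages by [f]; its indicator is in the kernel. *)
Lemma det_map_laplacian_not_rooted f :
  ~~ rooted f -> \det (fin_mx (map_laplacian f)) = 0.
Proof.
move=> /forallPn[v0 nv0].
pose a v : R := (~~ reaches_fixpoint f v)%:R.
apply: (@det_fin_mx_ker _ _ _ a v0) => [|u]; first by rewrite /a nv0.
rewrite /map_laplacian; under eq_bigr do rewrite mulrBl.
rewrite sumrB (bigD1 u) //= eqxx mul1r big1 ?addr0; last first.
  by move=> v /negbTE vu; rewrite eq_sym vu mul0r.
rewrite (bigD1 (f u)) //= eqxx andbT big1 ?addr0; last first.
  by move=> v /negbTE vu; rewrite [f u == v]eq_sym vu andbF mul0r.
rewrite /a reaches_fixpoint_step; case: eqVneq => [fu|_]; last by rewrite mul1r subrr.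
have -> : reaches_fixpoint f u by apply/reaches_fixpointP; exists 0%N.
by rewrite mul0r subr0.
Qed.

(** A fixed point of [f] stands for a root of the forest with edges
    [{v, f v}].  Each row of the matrix is a combination of rows of matrices
    [map_laplacian f], and the determinant is multilinear. *)
Lemma det_laplacian_forests (w : V -> V -> R) (y : V -> R) :
  \det (fin_mx (fun u v => laplacian w u v + (u == v)%:R * y u)) =
  \sum_(f : {ffun V -> V} | rooted f)
     \prod_v (if f v == v then y v else w v (f v)).
Proof.
pose c u z := if z == u then y u else w u z.
pose G (u z v : V) : R := (u == v)%:R - ((z != u) && (z == v))%:R.
rewrite (@eq_fin_mx _ _ _ (fun u v => \sum_z c u z * G u z v)).
  rewrite det_fin_mx_rows [RHS]big_mkcond; apply: eq_bigr => f _ /=.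
  have [rf|nf] := ifP; first by rewrite det_map_laplacian_rooted // mulr1.
  by rewrite det_map_laplacian_not_rooted ?mulr0 // nf.
move=> u v; rewrite /laplacian /c /G.
rewrite [X in _ * X - _](bigD1 u) //= [RHS](bigD1 u) //= eqxx /= subr0.
have [<-|uv] := eqVneq u v.
  rewrite [X in _ = _ + X](eq_bigr (fun z => w u z)) => [|z /negbTE zu].
    by rewrite !mul1r mulr1; ring.
  by rewrite zu subr0 mulr1.
have vu : v != u by rewrite eq_sym.
rewrite [in RHS](bigD1 v) //= eqxx (negbTE vu) /=.
rewrite [X in _ + (_ + X)]big1 => [|z /andP[/negbTE zu /negbTE zv]]; first by ring.
by rewrite zu zv /= subr0 mulr0.
Qed.

(** Both factors [1 + (a - e_r) 1^T] and [1 + 1 (b - e_r)^T] fix the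
    Laplacian, whose rows and columns sum to zero, and they carry [e_r e_r^T]
    to [a b^T]. *)
Lemma det_laplacian_rank1 (w : V -> V -> R) (r : V) (a b : V -> R) :
  (forall u v, w u v = w v u) ->
  \det (fin_mx (fun u v => laplacian w u v + a u * b v)) =
  (\sum_v a v) * (\sum_v b v) *
    \det (fin_mx (fun u v => laplacian w u v + (u == v)%:R * (u == r)%:R)).
Proof.
move=> wC.
have sum_delta (F : V -> R) v : \sum_u (u == v)%:R * F u = F v.
  rewrite (bigD1 v) //= eqxx mul1r big1 ?addr0 // => u /negbTE ->.
  by rewrite mul0r.
have sum_delta1 (v : V) : \sum_u (u == v)%:R = 1 :> R.
  by rewrite -[RHS](sum_delta (fun=> 1) v); apply: eq_bigr => u _; rewrite mulr1.
have row0 u : \sum_v laplacian w u v = 0.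
  rewrite /laplacian sumrB; under eq_bigr do rewrite eq_sym.
  by rewrite (sum_delta (fun=> \sum_z w u z)) subrr.
have col0 v : \sum_u laplacian w u v = 0.
  rewrite -[RHS](row0 v); apply: eq_bigr => u _.
  by rewrite /laplacian wC; case: eqVneq => [->|]; rewrite ?mul0r.
have detE (h : V -> R) :
    \det (fin_mx (fun u v => (u == v)%:R + (h u - (u == r)%:R) * 1)) = \sum_v h v.
  rewrite det_fin_mx_1D_rank1.
  under eq_bigr do rewrite mulr1.
  by rewrite sumrB sum_delta1 addrC subrK.
rewrite mulrAC -!detE -[X in _ * X]det_fin_mx_tr -!det_mulmx !fin_mxM.
congr (\det _); apply: eq_fin_mx => u v.
have step1 z : \sum_t ((u == t)%:R + (a u - (u == r)%:R) * 1) *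
      (laplacian w t z + (t == z)%:R * (t == r)%:R)
    = laplacian w u z + a u * (z == r)%:R.
  under eq_bigr => t _ do rewrite mulr1 mulrDl [u == t]eq_sym.
  rewrite big_split /= sum_delta -mulr_sumr big_split /= col0 sum_delta add0r.
  have [->|_] := eqVneq u r; last by rewrite mulr0 addr0 subr0.
  by rewrite [r == z]eq_sym mulr1 mulrBl mul1r addrACA subrr addr0.
under eq_bigr => z _ do rewrite step1 mulr1 mulrDr [v == z]eq_sym
   [_ * (z == v)%:R]mulrC.
rewrite big_split /= sum_delta -mulr_suml big_split /= row0 -mulr_sumr.
by rewrite sum_delta1; ring.
Qed.

End Forest.

(** * Spanning trees as parent maps *)

Section SpanningTrees.
Variable V : finType.
Implicit Types (T : {set {set V}}) (f : V -> V) (e : rel V).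

Lemma eq_set2 (u v z t : V) :
  u != v -> [set u; v] = [set z; t] -> (u = z /\ v = t) \/ (u = t /\ v = z).
Proof.
move=> uv E.
have /set2P hu : u \in [set z; t] by rewrite -E set21.
have /set2P hv : v \in [set z; t] by rewrite -E set22.
by case: hu hv => hu [] hv; [|left|right|]; rewrite // hu hv eqxx in uv.
Qed.

Lemma adj_sym T : ssrbool.symmetric (adj T).
Proof. by move=> u v; rewrite -[LHS]/(_ && _) eq_sym setUC. Qed.

Lemma adj_sub T T' : T' \subset T -> subrel (adj T') (adj T).
Proof. by move=> /subsetP sT u v /andP[uv /sT uvT]; rewrite /adj /= uv. Qed.

(** An edge of [T] outside the connected [T'] would close a cycle with a
    simple path of [T'] joining its ends. *)
Lemma connected_sub_acyclic e T T' :
  irreflexive e -> T \subset edges e -> is_acyclic T ->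
  T' \subset T -> is_connected T' -> T' = T.
Proof.
move=> e_irr /subsetP Te /is_acyclicP acT sT /forallP coT.
apply/eqP; rewrite eqEsubset sT; apply/subsetP => a aT.
have /imsetP[[u v] /= euv Da] := Te a aT; rewrite inE /= in euv; subst a.
have uv : u != v by apply: contraTneq euv => ->; rewrite e_irr.
have /forallP/(_ v)/connectP[p0 p0P vE] := coT u.
have [p pP [up vp]] : exists2 p, path (adj T') u p & uniq (u :: p) /\ v = last u p.
  by case/shortenP: p0P vE => p pP up _ ->; exists p.
apply: contraT => aT'; case: (acT (u :: p)).
  case: p pP vp {up} => [|x [|y p]] //=; first by move=> _ E; rewrite E eqxx in uv.
  by move=> /andP[/andP[_ ux] _] E; rewrite E ux in aT'.
rewrite /ucycle up andbT /= rcons_path (sub_path (adj_sub sT) pP) /= -vp.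
by rewrite adj_sym; apply/andP.
Qed.

Section ParentMaps.
Variable r : V.

Definition parent_map f : bool := (f r == r) && [forall v, fconnect f v r].

Definition tree_of f : {set {set V}} := [set [set v; f v] | v in [set~ r]].

Section OneMap.
Variable f : V -> V.
Hypothesis fP : parent_map f.

(** The depth of [v] in the tree: the number of steps from [v] to [r]. *)
Definition height v := findex f v r.

Lemma height_parent v : v != r -> height v = (height (f v)).+1.
Proof.
by case/andP: fP => _ /forallP/(_ v) vr vNr; rewrite /height fconnect_findex // eq_sym.
Qed.

Lemma parent_neq v : v != r -> f v != v.
Proof. by move=> /height_parent hv; apply/eqP => fv; move: hv; rewrite fv => /n_Sn. Qed.

Lemma grandparent_neq v : v != r -> f (f v) != v.
Proof.
move=> vr; apply/eqP => ffv; have := height_parent vr.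
have [fvr|/height_parent ->] := eqVneq (f v) r.
  by case/andP: fP => /eqP fr _; move: vr; rewrite -{1}ffv fvr fr eqxx.
by rewrite ffv => /eqP; rewrite -[X in X == _]addn0 -addn2 eqn_add2l.
Qed.

Lemma adj_tree_of u v :
  adj (tree_of f) u v = ((u != r) && (f u == v)) || ((v != r) && (f v == u)).
Proof.
apply/andP/orP => [[uv /imsetP[z]]|].
  rewrite !inE => zr /(eq_set2 uv)[[-> ->]|[-> ->]]; [left|right];
    by rewrite zr eqxx.
case=> /andP[zr /eqP <-]; split.
- by rewrite eq_sym parent_neq.
- by apply/imsetP; exists u; rewrite ?inE.
- exact: parent_neq.
- by apply/imsetP; exists v; rewrite ?inE // setUC.
Qed.

(** At a vertex of maximal height on a cycle, both neighbours along the cycle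
    would be its parent. *)
Lemma tree_of_acyclic : is_acyclic (tree_of f).
Proof.
apply/is_acyclicP => c c2 /andP[cc uc].
have [x0 x0c] : exists x, x \in c.
  by case: c c2 {cc uc} => // x c _; exists x; rewrite mem_head.
case: (arg_maxnP height x0c) => v vc vmax.
have [i s rE] := rot_to vc.
have up a : a \in c -> adj (tree_of f) v a -> f v = a.
  move=> ac; rewrite adj_tree_of => /orP[/andP[_ /eqP //]|/andP[ar /eqP fa]].
  by have := vmax a ac; rewrite /= (height_parent ar) fa ltnn.
have mc a : (a \in c) = (a \in v :: s) by rewrite -rE mem_rot.
rewrite -(rot_uniq i) rE in uc; rewrite -(rot_cycle i) rE in cc.
rewrite -(size_rot i) rE in c2.
case: s => [|a s] in rE mc uc cc c2 *; first by [].
case/lastP: s => [|s b] in rE mc uc cc c2 *; first by [].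
move: cc; rewrite /= rcons_path last_rcons [adj _ b v]adj_sym => /and3P[va _ bv].
have fa : f v = a by apply: up; rewrite // mc !inE eqxx orbT.
have fb : f v = b by apply: up => //; rewrite mc !inE mem_rcons mem_head !orbT.
by move: uc; rewrite /= -fa fb mem_rcons mem_head /= andbF.
Qed.

Lemma tree_of_connected : is_connected (tree_of f).
Proof.
have conr v : connect (adj (tree_of f)) v r.
  have [n] := ubnP (height v); elim: n v => // n IH v hv.
  have [->|vr] := eqVneq v r; first exact: connect0.
  apply: connect_trans (connect1 _) (IH (f v) _).
    by rewrite adj_tree_of vr eqxx.
  by move: hv; rewrite (height_parent vr).
apply/forallP => u; apply/forallP => v; apply: connect_trans (conr u) _.
by rewrite (sym_connect_sym (@adj_sym _)).
Qed.

(** Two vertices defining the same edge would be parents of each other. *)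
Lemma tree_of_edges_inj : {in [set~ r] &, injective (fun v => [set v; f v])}.
Proof.
move=> u v; rewrite !inE => ur vr.
rewrite eq_sym in ur *; move=> /eq_set2.
rewrite eq_sym parent_neq 1?eq_sym // => /(_ isT) [[]|[uE vE]] //.
by have := grandparent_neq vr; rewrite -uE vE eqxx.
Qed.

End OneMap.

(** If the maps differ at [v], then [g] must send [f v] back to [v]; at a
    disagreement of least height this contradicts their agreement at [f v]. *)
Lemma tree_of_inj f g :
  parent_map f -> parent_map g -> tree_of f = tree_of g -> f =1 g.
Proof.
move=> fP gP fg v; have [n] := ubnP (height f v); elim: n v => // n IH v hv.
have [fr gr] : f r = r /\ g r = r by case/andP: fP => /eqP-> _; case/andP: gP => /eqP-> _.
have [->|vr] := eqVneq v r; first by rewrite fr gr.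
have : adj (tree_of g) v (f v) by rewrite -fg adj_tree_of // vr eqxx.
rewrite adj_tree_of // => /orP[/andP[_ /eqP //]|/andP[fvr /eqP gfv]].
have := grandparent_neq fP vr; rewrite IH ?gfv ?eqxx //.
by move: hv; rewrite (height_parent fP vr).
Qed.

(** A parent map is obtained by sending each vertex to a neighbour closer to
    [r]; its tree is all of [T] because [T] has no cycle. *)
Lemma tree_of_surj e T :
  irreflexive e -> T \in Tree e -> exists2 f, parent_map f & tree_of f = T.
Proof.
move=> e_irr; rewrite inE => /and3P[Te coT acT].
pose P v k := [exists p : k.-tuple V, path (adj T) v p && (last v p == r)].
have exP v : exists k, P v k.
  have /forallP/(_ v)/forallP/(_ r)/connectP[p pP rE] := coT.
  by exists (size p); apply/existsP; exists (in_tuple p); rewrite pP rE /=.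
pose d v := ex_minn (exP v).
have dP v : v != r -> exists u, adj T v u && (d u < d v)%N.
  move=> vr; rewrite [d v]/d; case: ex_minnP => k /existsP[p /andP[pP /eqP pr]] _.
  case: k p pP pr => [p|k p]; first by rewrite (tuple0 p) /= => _ E; rewrite E eqxx in vr.
  case/tupleP: p => u p /= /andP[vu pP] pr; exists u; rewrite vu /=.
  rewrite /d; case: ex_minnP => m _; apply; apply/existsP; exists p.
  by rewrite pP pr /=.
pose f v := if v == r then r else odflt r [pick u | adj T v u && (d u < d v)%N].
have fN v : v != r -> adj T v (f v) && (d (f v) < d v)%N.
  move=> vr; rewrite /f (negbTE vr); case: pickP => [//|no].
  by have [u] := dP v vr; rewrite no.
have fP : parent_map f.
  rewrite /parent_map {1}/f !eqxx; apply/forallP => v.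
  have [n] := ubnP (d v); elim: n v => // n IH v hv.
  have [->|vr] := eqVneq v r; first exact: connect0.
  have /andP[_ dfv] := fN v vr.
  apply: connect_trans (fconnect1 f v) (IH _ _); exact: leq_trans dfv _.
exists f => //; apply: connected_sub_acyclic e_irr Te acT _ (tree_of_connected fP).
apply/subsetP => a /imsetP[v]; rewrite !inE => vr ->.
by have /andP[/andP[]] := fN v vr.
Qed.

End ParentMaps.

Lemma mem_edges e u v : ssrbool.symmetric e -> irreflexive e ->
   ([set u; v] \in edges e) = e u v.
Proof.
move=> eC e0; apply/imsetP/idP => [[[z t]]|euv]; last by exists (u, v); rewrite ?inE.
rewrite inE /= => ezt.
have [->|uv] := eqVneq u v.
  move=> E; move: ezt; have : z \in [set v; v] by rewrite E set21.
  have : t \in [set v; v] by rewrite E set22.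
  by rewrite !inE !orbb => /eqP-> /eqP->.
by case/(eq_set2 uv) => -[-> ->]; rewrite // eC.
Qed.

Lemma tree_of_Tree e r f : ssrbool.symmetric e -> irreflexive e -> parent_map r f ->
  (tree_of r f \in Tree e) = [forall v, (v != r) ==> e v (f v)].
Proof.
move=> eC e0 fP; rewrite inE /is_spanning_tree tree_of_connected //.
rewrite tree_of_acyclic // !andbT.
apply/subsetP/forallP => [sub v|ef a /imsetP[v]].
  apply/implyP => vr; rewrite -mem_edges //; apply: sub.
  by apply/imsetP; exists v; rewrite ?inE.
by rewrite !inE => vr ->; rewrite mem_edges //; have /implyP := ef v; apply.
Qed.

(** Rooting at [r] makes spanning trees correspond to parent maps, and each
    edge of the tree to its end away from the root. *)
Lemma sum_trees_parent_maps (R : comNzRingType) e r (W : {set V} -> R) :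
  ssrbool.symmetric e -> irreflexive e ->
  \sum_(T in Tree e) \prod_(a in T) W a =
  \sum_(f : {ffun V -> V} |
        parent_map r f && [forall v, (v != r) ==> e v (f v)])
     \prod_(v | v != r) W [set v; f v].
Proof.
move=> eC e0.
pose A := [set f : {ffun V -> V} |
        parent_map r f && [forall v, (v != r) ==> e v (f v)]].
have -> : Tree e = [set tree_of r f | f : {ffun V -> V} in A].
  apply/setP => T; apply/idP/imsetP => [TT|[f]].
    have [f fP fT] := tree_of_surj r e0 TT.
    have ff : finfun f =1 f by move=> v; rewrite ffunE.
    have f'T : tree_of r (finfun f) = T.
      by rewrite -fT; apply: eq_imset => v; rewrite ff.
    have f'P : parent_map r (finfun f).
      case/andP: fP => /eqP fr /forallP fc; rewrite /parent_map ff fr eqxx.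
      by apply/forallP => v; rewrite (eq_fconnect ff).
    by exists (finfun f); rewrite // inE f'P -tree_of_Tree // f'T.
  by rewrite inE => /andP[fP ef] ->; rewrite tree_of_Tree.
rewrite big_imset /=; last first.
  move=> f g; rewrite !inE => /andP[fP _] /andP[gP _] fg.
  by apply/ffunP/(tree_of_inj fP gP).
apply: eq_big => [f|f]; first by rewrite inE.
rewrite inE => /andP[fP _].
rewrite big_imset; last exact: tree_of_edges_inj.
by apply: eq_bigl => v; rewrite !inE.
Qed.

(** In the forest expansion with diagonal weights [1] at [r] and [0] elsewhere,
    the surviving maps have [r] as their only fixed point and follow edges. *)
Theorem weighted_matrix_tree (R : comNzRingType) e r (W : {set V} -> R)
    (w := fun u v => if e u v then W [set u; v] else 0) :
  ssrbool.symmetric e -> irreflexive e ->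
  \det (fin_mx (fun u v => laplacian w u v + (u == v)%:R * (u == r)%:R)) =
  \sum_(T in Tree e) \prod_(a in T) W a.
Proof.
move=> eC e0; rewrite (sum_trees_parent_maps r _ eC e0).
rewrite (det_laplacian_forests w (fun u => (u == r)%:R)).
rewrite big_mkcond [RHS]big_mkcond; apply: eq_bigr => f _ /=.
have [/andP[fP /forallP ef]|bad] :=
  boolP (parent_map r f && [forall v, (v != r) ==> e v (f v)]).
  have fr : f r = r by have /andP[/eqP] := fP.
  have -> : rooted f.
    apply/forallP => v; apply/existsP; exists r; rewrite fr eqxx andbT.
    by have /andP[_ /forallP] := fP.
  (* The root contributes the [1] added to the diagonal. *)
  rewrite (bigD1 r) //= fr !eqxx mul1r; apply: eq_bigr => v vr.
  by rewrite (negbTE (parent_neq fP vr)) /w; have /implyP-> := ef v.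
have [/forallP rf|//] := ifP.
have [/existsP[v /andP[vr /eqP fv]]|/existsPn nofix] :=
  boolP [exists v, (v != r) && (f v == v)].
  by rewrite (bigD1 v) //= fv eqxx (negbTE vr) mul0r.
have fixr v : f v = v -> v = r.
  by move=> fv; apply/eqP; have := nofix v; rewrite fv eqxx andbT negbK.
have fP : parent_map r f.
  apply/andP; split; last apply/forallP => v.
    by have /existsP[x /andP[_ /eqP fx]] := rf r; rewrite -(fixr x fx) fx.
  by have /existsP[x /andP[vx /eqP fx]] := rf v; rewrite -(fixr x fx).
move: bad; rewrite fP /= => /forallPn[v]; rewrite negb_imply => /andP[vr /negbTE ev].
by rewrite (bigD1 v) //= (negbTE (parent_neq fP vr)) /w ev mul0r.
Qed.

End SpanningTrees.

(** * The Laplacian of the cube in an orthogonal basis of tensors *)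

Lemma ord2P (t : 'I_2) : t = 0 \/ t = 1.
Proof.
by case: t => [[|[|//]] i]; [left|right]; apply: val_inj.
Qed.

Lemma sum_ord2 (R : nmodType) (G : 'I_2 -> R) : \sum_t G t = G 0 + G 1.
Proof.
by rewrite !big_ord_recl big_ord0 addr0; congr (_ + G _); apply: val_inj.
Qed.

Lemma edge_direction n (u v : cube_vertex n) (i : 'I_n) :
  in_direction i [set u; v] = (u i != v i).
Proof.
apply/idP/idP => [/exists_inP[z + /exists_inP[t]]|uv].
  by rewrite !inE => /orP[]/eqP-> /orP[]/eqP->; rewrite ?eqxx // eq_sym.
apply/exists_inP; exists u; rewrite ?set21 //.
by apply/exists_inP; exists v; rewrite ?set22.
Qed.

Lemma Q_sym n : ssrbool.symmetric (Q n).
Proof.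
move=> u v; apply: eq_existsb => i; rewrite /complete_graph /= eq_sym; congr (_ && _).
by apply: eq_forallb => j; rewrite [u j == _]eq_sym.
Qed.

Lemma Q_irr n : irreflexive (Q n).
Proof. by move=> u; apply/negbTE/existsPn => i; rewrite /complete_graph /= eqxx. Qed.

Section Cube.
Variables (F : fieldType) (n : nat) (q s : 'I_n -> F).
Hypothesis s_neq0 : forall i, s i != 0.

Let V := cube_vertex n.

Definition coord_weight (i : 'I_n) (t : 'I_2) : F := if t == 0 then (s i)^-1 else s i.

Definition vweight (v : V) : F := \prod_i coord_weight i (v i).

Definition eweight (a : {set V}) : F :=
  (\prod_(i | in_direction i a) q i) * \prod_(v in a) vweight v.

Definition cube_weight (u v : V) : F :=
  if Q n u v then eweight [set u; v] else 0.

(** The value of [x_i^(-1) + x_i]; also the squared norm of both vectors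
    [eigv i 0] and [eigv i 1] below. *)
Definition coord_norm (i : 'I_n) : F := (s i ^+ 2)^-1 + s i ^+ 2.

Lemma coord_norm_eq0 i : (coord_norm i == 0) = (1 + s i ^+ 4 == 0).
Proof.
have si := s_neq0 i.
have -> : coord_norm i = (1 + s i ^+ 4) / s i ^+ 2 by rewrite /coord_norm; field.
by rewrite mulf_eq0 invr_eq0 expf_eq0 (negbTE si) andbF orbF.
Qed.

(** Up to the factor [q i], the weight of an edge in direction [i], as a tensor
    product over the coordinates; it vanishes on all other pairs of vertices. *)
Definition dir_tensor (i : 'I_n) (u v : V) : F :=
  \prod_j (if j == i then (u j != v j)%:R
           else (u j == v j)%:R * coord_weight j (u j) ^+ 2).

(** Along an edge in direction [i] the two weights at coordinate [i] cancel,
    and the others are squared. *)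
Lemma cube_weightE (u v : V) :
  cube_weight u v = \sum_i q i * dir_tensor i u v.
Proof.
rewrite /cube_weight; have [/existsP[i /andP[/= ui /forallP uj]]|/existsPn nQ] := ifPn.
  have {}ui : u i != v i by [].
  have eqj j : j != i -> u j = v j by move=> ji; have /implyP/(_ ji)/eqP := uj j.
  have uv : u != v by apply: contraNneq ui => ->.
  rewrite /eweight big_setU1 ?inE //= big_set1 [RHS](bigD1 i) //=.
  rewrite [X in _ = _ + X]big1 ?addr0; last first.
    move=> k ki; rewrite /dir_tensor (bigD1 i) //= eq_sym (negbTE ki).
    by rewrite (negbTE ui) !mul0r mulr0.
  congr (_ * _).
    rewrite (eq_bigl (pred1 i)) ?big_pred1_eq // => k /=.
    by rewrite edge_direction; case: (eqVneq k i) => [->|/eqj ->]; rewrite ?ui ?eqxx.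
  rewrite -big_split; apply: eq_bigr => j _ /=; case: eqVneq => [->|/eqj ->].
    rewrite ui /coord_weight; move: ui.
    by case: (ord2P (u i)) (ord2P (v i)) => -> [] -> //= _; rewrite ?mulVf ?mulfV.
  by rewrite eqxx mul1r expr2.
rewrite big1 // => i _; apply/eqP; rewrite mulf_eq0; apply/orP; right.
rewrite /dir_tensor; have := nQ i; rewrite negb_and negbK => /orP[ui|/forallPn[j]].
  by rewrite (bigD1 i) //= eqxx ui mul0r.
rewrite negb_imply => /andP[ji uj].
by rewrite (bigD1 j) //= (negbTE ji) (negbTE uj) !mul0r.
Qed.

(** For the scalar product with weights [coord_weight i t ^+ 2], these are the
    eigenvectors of the Laplacian of a single edge: the constants, and the
    vectors orthogonal to them. *)
Definition eigv (i : 'I_n) (b t : 'I_2) : F :=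
  if b == 0 then 1 else if t == 0 then s i ^+ 2 else - (s i ^+ 2)^-1.

Definition eigtensor (B v : V) : F := \prod_i eigv i (B i) (v i).

Lemma sum_tensor (G : 'I_n -> 'I_2 -> F) :
  \sum_(v : V) \prod_j G j (v j) = \prod_j \sum_t G j t.
Proof. by rewrite bigA_distr_bigA. Qed.

Lemma sum2_tensor (G : 'I_n -> 'I_2 -> 'I_2 -> F) :
  \sum_(u : V) \sum_(v : V) \prod_j G j (u j) (v j) =
  \prod_j \sum_t \sum_t' G j t t'.
Proof.
rewrite -sum_tensor; apply: eq_bigr => u _.
by rewrite (sum_tensor (fun j => G j (u j))).
Qed.

Lemma prod_delta (A B : V) (a : 'I_n -> F) :
  \prod_j ((A j == B j)%:R * a j) = (A == B)%:R * \prod_j a j.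
Proof.
have [->|AB] := eqVneq A B.
  by rewrite mul1r; apply: eq_bigr => j _; rewrite eqxx mul1r.
have /existsP[j jAB] : [exists j, A j != B j].
  apply: contraR AB => /existsPn AB; apply/eqP/ffunP => j.
  by apply/eqP; rewrite -[_ == _]negbK.
by rewrite mul0r (bigD1 j) //= (negbTE jAB) !mul0r.
Qed.

Lemma eigv_orth i a b :
  \sum_t coord_weight i t ^+ 2 * eigv i a t * eigv i b t = (a == b)%:R * coord_norm i.
Proof.
have si := s_neq0 i.
rewrite sum_ord2 /coord_weight /eigv /coord_norm.
by case: (ord2P a) (ord2P b) => -> [] -> /=; field.
Qed.

Lemma eigtensor_orth A B :
  \sum_v vweight v ^+ 2 * eigtensor A v * eigtensor B v =
  (A == B)%:R * \prod_i coord_norm i.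
Proof.
rewrite -prod_delta; under [RHS]eq_bigr do rewrite -eigv_orth.
rewrite -sum_tensor; apply: eq_bigr => v _.
by rewrite -prodrXl -!big_split.
Qed.

Lemma eigv_edge i a b :
  (\sum_t \sum_t' (t != t')%:R * eigv i a t * eigv i b t) -
  (\sum_t \sum_t' (t != t')%:R * eigv i a t * eigv i b t') =
  (a == b)%:R * (a != 0)%:R * coord_norm i ^+ 2.
Proof.
have si := s_neq0 i.
rewrite !sum_ord2 /eigv /coord_norm.
by case: (ord2P a) (ord2P b) => -> [] -> /=; field.
Qed.

(** Both parts of the difference are sums of tensors, so they factor over the
    coordinates; they differ only in the factor at [i], and orthogonality
    evaluates all the other ones. *)
Lemma dir_tensor_form i A B :
  \sum_u \sum_v dir_tensor i u v * eigtensor A u * (eigtensor B u - eigtensor B v)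
  = (A == B)%:R * (\prod_j coord_norm j) * ((A i != 0)%:R * coord_norm i).
Proof.
pose H (G : 'I_2 -> 'I_2 -> F) := fun j t t' => if j == i then G t t'
  else (t == t')%:R * (coord_weight j t ^+ 2 * eigv j (A j) t * eigv j (B j) t).
have HE G : \prod_j \sum_t \sum_t' H G j t t' =
   (\sum_t \sum_t' G t t') * \prod_(j | j != i) ((A j == B j)%:R * coord_norm j).
  rewrite (bigD1 i) //= {1}/H eqxx; congr (_ * _).
  apply: eq_bigr => j /negbTE ji; rewrite /H ji -eigv_orth; apply: eq_bigr => t _.
  rewrite (bigD1 t) //= eqxx mul1r big1 ?addr0 // => t' /negbTE tt'.
  by rewrite eq_sym tt' mul0r.
pose G1 t t' := (t != t')%:R * eigv i (A i) t * eigv i (B i) t.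
pose G2 t t' := (t != t')%:R * eigv i (A i) t * eigv i (B i) t'.
transitivity (\prod_j \sum_t \sum_t' H G1 j t t' - \prod_j \sum_t \sum_t' H G2 j t t').
  rewrite -!sum2_tensor -sumrB; apply: eq_bigr => u _.
  rewrite -sumrB; apply: eq_bigr => v _; rewrite mulrBr; congr (_ - _).
    rewrite -!big_split; apply: eq_bigr => j _ /=; rewrite /H /G1.
    by case: eqVneq => [->|_]; rewrite // !mulrA.
  rewrite -!big_split; apply: eq_bigr => j _ /=; rewrite /H /G2.
  case: eqVneq => [->|_]; rewrite //.
  by case: eqVneq => [->|_]; rewrite ?mul0r ?mul1r //.
rewrite !HE -mulrBl eigv_edge -prod_delta [in RHS](bigD1 i) //=.
by rewrite expr2; ring.
Qed.

(** The value of the Laplacian at [u] is the sum over [v] of the edge weight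
    times a difference of values at [u] and [v]; the directions contribute to
    it separately. *)
Lemma laplacian_eigtensor A B :
  \sum_u \sum_v eigtensor A u * laplacian cube_weight u v * eigtensor B v =
  (A == B)%:R * (\prod_j coord_norm j) * \sum_(i | A i != 0) q i * coord_norm i.
Proof.
transitivity (\sum_u \sum_v
    cube_weight u v * eigtensor A u * (eigtensor B u - eigtensor B v)).
  apply: eq_bigr => u _; rewrite /laplacian.
  under eq_bigr do rewrite mulrBr mulrBl.
  under [RHS]eq_bigr do rewrite mulrBr.
  rewrite !sumrB; congr (_ - _); last first.
    by apply: eq_bigr => v _; rewrite [_ * eigtensor A u]mulrC.
  rewrite (bigD1 u) //= eqxx mul1r [X in _ + X]big1 ?addr0 => [|v /negbTE vu].
    by rewrite -!mulr_suml [_ * eigtensor A u]mulrC.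
  by rewrite eq_sym vu mul0r mulr0 mul0r.
transitivity (\sum_u \sum_i \sum_v q i * dir_tensor i u v * eigtensor A u
                * (eigtensor B u - eigtensor B v)).
  apply: eq_bigr => u _; rewrite [RHS]exchange_big; apply: eq_bigr => v _ /=.
  by rewrite cube_weightE !mulr_suml.
rewrite exchange_big /= [X in _ = _ * X]big_mkcond [RHS]mulr_sumr.
apply: eq_bigr => i _.
transitivity (q i * ((A == B)%:R * (\prod_j coord_norm j)
                     * ((A i != 0)%:R * coord_norm i))).
  rewrite -dir_tensor_form mulr_sumr; apply: eq_bigr => u _.
  by rewrite mulr_sumr; apply: eq_bigr => v _; rewrite !mulrA.
by case: (A i != 0); rewrite ?mul0r ?mulr0 // mul1r mulrCA.
Qed.

(** Complementing all coordinates inverts the weight of a vertex. *)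
Lemma prod_vweight : \prod_v vweight v ^+ 2 = 1.
Proof.
pose comp (v : V) : V := [ffun i => if v i == 0 then 1 else 0].
have compK : involutive comp.
  by move=> v; apply/ffunP => i; rewrite !ffunE; case: (ord2P (v i)) => ->.
under eq_bigr do rewrite expr2.
rewrite big_split {1}(reindex_inj (inv_inj compK)) -big_split big1 // => v _.
rewrite -big_split big1 // => i _ /=; rewrite ffunE /coord_weight.
by case: (ord2P (v i)) => -> /=; rewrite ?mulVf ?mulfV.
Qed.

Hypothesis coord_norm_neq0 : forall i, coord_norm i != 0.

(** A vertex stands for the set of directions where it is not [0]; singletons
    are split off. *)
Lemma prod_nonempty_sets (q' : 'I_n -> F) :
  \prod_(A : V | A != [ffun=> 0]) \sum_(i | A i != 0) q' i =
  (\prod_i q' i) * \prod_(A : {set 'I_n} | (2 <= #|A|)%N) \sum_(i in A) q' i.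
Proof.
pose h (A : {set 'I_n}) : V := [ffun i => if i \in A then 1 else 0].
pose k (B : V) : {set 'I_n} := [set i | B i != 0].
have hk : cancel h k by move=> A; apply/setP => i; rewrite inE ffunE; case: ifP.
have kh : cancel k h.
  by move=> B; apply/ffunP => i; rewrite ffunE inE; case: (ord2P (B i)) => ->.
rewrite (reindex h); last by apply: onW_bij; exists k.
have hA0 A : (h A != [ffun=> 0]) = (0 < #|A|)%N.
  rewrite card_gt0; congr (~~ _); rewrite -(can_eq hk); congr (_ == _).
  by apply/ffunP => i; rewrite !ffunE inE.
rewrite (eq_bigr (fun A : {set 'I_n} => \sum_(i in A) q' i)) => [|A _]; last first.
  by apply: eq_bigl => i; rewrite ffunE; case: ifP.
rewrite (eq_bigl _ _ hA0) (bigID (fun A : {set 'I_n} => (#|A| == 1)%N)) /=.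
congr (_ * _); last first.
  by apply: eq_bigl => A; case: #|A| => [|[]].
rewrite (eq_bigl (mem [set [set i] | i : 'I_n])) /=.
  rewrite big_imset /=; last by move=> i j _ _; apply: set1_inj.
  by apply: eq_bigr => i _; rewrite big_set1.
move=> A; apply/andP/imsetP => [[_ /cards1P[i ->]]|[i _ ->]]; first by exists i.
by rewrite cards1.
Qed.

Lemma sum_vweight2 : \sum_v vweight v ^+ 2 = \prod_i coord_norm i.
Proof.
have := eigtensor_orth [ffun=> 0] [ffun=> 0]; rewrite eqxx mul1r => <-.
apply: eq_bigr => v _; rewrite /eigtensor [\prod_i eigv _ _ _]big1 ?mulr1 //.
by move=> i _; rewrite /eigv ffunE eqxx.
Qed.

(** The tensors diagonalize both this matrix and the diagonal matrix of the
    [vweight v ^+ 2]; since the latter has determinant [1], it gives the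
    squared determinant of the change of basis.  The rank one term is chosen to
    be orthogonal to all the tensors but the constant one, where it replaces
    the eigenvalue zero of the Laplacian. *)
Lemma det_cube_laplacian :
  \det (fin_mx (fun u v => laplacian cube_weight u v
                        + vweight u ^+ 2 * vweight v ^+ 2)) =
  (\prod_i coord_norm i) *
  \prod_(A : V | A != [ffun=> 0]) \sum_(i | A i != 0) q i * coord_norm i.
Proof.
set c0 := \prod_i coord_norm i.
pose M (u v : V) := laplacian cube_weight u v + vweight u ^+ 2 * vweight v ^+ 2.
rewrite -[fin_mx _]/(fin_mx M).
have c0N : c0 != 0 by apply/prodf_neq0.
pose P (v A : V) := eigtensor A v; pose Pt (A v : V) := eigtensor A v.
have detPt : \det (fin_mx Pt) = \det (fin_mx P) by exact: det_fin_mx_tr.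
have eig0 v : eigtensor [ffun=> 0] v = 1.
  by rewrite /eigtensor big1 // => i _; rewrite /eigv ffunE eqxx.
have eq1 : \det (fin_mx P) ^+ 2 = \prod_(A : V) c0.
  have detX : \det (fin_mx (fun u v : V => (u == v)%:R * vweight u ^+ 2)) = 1.
    by rewrite det_fin_mx_diag prod_vweight.
  rewrite -det_fin_mx_diag expr2 -{1}detPt -[LHS]mulr1 -[X in _ * X]detX.
  rewrite mulrAC -!det_mulmx !fin_mxM; congr (\det _); apply: eq_fin_mx => A B.
  rewrite /c0 -eigtensor_orth; apply: eq_bigr => v _; congr (_ * _).
  rewrite (bigD1 v) //= eqxx mul1r big1 ?addr0 1?mulrC // => u /negbTE uv.
  by rewrite uv mul0r mulr0.
pose d (A : V) :=
  c0 * (if A == [ffun=> 0] then c0 else \sum_(i | A i != 0) q i * coord_norm i).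
have eq2 : \det (fin_mx P) ^+ 2 * \det (fin_mx M) = \prod_A d A.
  rewrite -det_fin_mx_diag expr2 mulrAC -{1}detPt -!det_mulmx !fin_mxM.
  congr (\det _); apply: eq_fin_mx => A B.
  transitivity (\sum_u \sum_v eigtensor A u * M u v * eigtensor B v).
    rewrite exchange_big; apply: eq_bigr => v _ /=.
    by rewrite -mulr_suml.
  transitivity (\sum_u \sum_v eigtensor A u * laplacian cube_weight u v * eigtensor B v
     + \sum_u \sum_v eigtensor A u * (vweight u ^+ 2 * vweight v ^+ 2) * eigtensor B v).
    rewrite -big_split; apply: eq_bigr => u _ /=; rewrite -big_split.
    by apply: eq_bigr => v _; rewrite /M mulrDr mulrDl.
  rewrite laplacian_eigtensor -/c0.
  have aE C : \sum_u vweight u ^+ 2 * eigtensor C u = (C == [ffun=> 0])%:R * c0.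
    by rewrite /c0 -eigtensor_orth; apply: eq_bigr => u _; rewrite eig0 mulr1.
  have -> : \sum_u \sum_v
      eigtensor A u * (vweight u ^+ 2 * vweight v ^+ 2) * eigtensor B v
     = ((A == [ffun=> 0])%:R * c0) * ((B == [ffun=> 0])%:R * c0).
    rewrite -!aE mulr_suml; apply: eq_bigr => u _; rewrite mulr_sumr.
    by apply: eq_bigr => v _; ring.
  rewrite /d; have [<-|AB] := eqVneq A B; last first.
    rewrite !mul0r add0r; have [A0|_] := eqVneq A _; last by rewrite !mul0r.
    by rewrite -A0 eq_sym (negbTE AB) mul0r mulr0.
  have [->|_] := eqVneq A _; last by rewrite !mul0r !mul1r addr0.
  by rewrite big1 => [|i]; [rewrite !mul1r mulr0 add0r|rewrite ffunE eqxx].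
have KN : \prod_(A : V) c0 != 0 by apply/prodf_neq0.
apply: (mulfI KN); rewrite -{1}eq1 eq2 big_split /=; congr (_ * _).
rewrite (bigD1 [ffun=> 0]) //= eqxx; congr (_ * _).
by apply: eq_bigr => A /negbTE ->.
Qed.

(** The determinant of the rank one perturbation of the Laplacian is known both
    from its eigenvectors and, with [r] any vertex, from the trees. *)
Theorem cube_tree_sum :
  \sum_(T in Tree (Q n)) \prod_(a in T) eweight a =
  (\prod_i q i) *
  \prod_(A : {set 'I_n} | (2 <= #|A|)%N) \sum_(i in A) q i * coord_norm i.
Proof.
set r : V := [ffun=> 0].
have c0N : \prod_i coord_norm i != 0 by apply/prodf_neq0.
rewrite -(weighted_matrix_tree r _ (@Q_sym n) (@Q_irr n)).
have wC (u v : V) : cube_weight u v = cube_weight v u.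
  by rewrite /cube_weight Q_sym setUC.
apply: (mulfI c0N); apply: (mulfI c0N); rewrite mulrA -{1 2}sum_vweight2.
rewrite -det_laplacian_rank1 // det_cube_laplacian prod_nonempty_sets big_split /=.
by congr (_ * _); rewrite mulrCA mulrA.
Qed.

End Cube.

(** * Specialization at the formal square roots *)

Section Substitution.
Variable n : nat.

(** The exponents of [q_dir] and [x_dd] count edges of the tree; exchanging
    the products collects the contribution of each edge. *)
Lemma subst_sum_trees :
  subst (\sum_(T in Tree (Q n)) q_dir T * x_dd T : cube_poly n) =
  \sum_(T in Tree (Q n)) \prod_(a in T) eweight (@fq n) (@sqrt_x n) a.
Proof.
rewrite /subst rmorph_sum; apply: eq_bigr => T _.
rewrite rmorphM /= big_split /=; congr (_ * _).
  rewrite rmorph_prod (exchange_big_dep predT) //=; apply: eq_bigr => i _.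
  rewrite rmorphXn /= [mmap _ _ _](subst_pq i) -prodr_const.
  by apply: eq_bigl => a; rewrite inE.
rewrite rmorph_prod (exchange_big_dep predT) //=; apply: eq_bigr => v _.
rewrite rmorphXn /= rmorph_prod.
rewrite (eq_bigr (fun i => coord_weight (@sqrt_x n) i (v i))) => [|i _]; last first.
  by case: (ord2P (v i)) => ->; [exact: subst_px1|exact: subst_px2].
by rewrite /deg -prodr_const; apply: eq_bigl => a; rewrite inE.
Qed.

Lemma sqrt_x_neq0 (i : 'I_n) : sqrt_x i != 0.
Proof.
rewrite /sqrt_x tofrac_eq0; apply/eqP => /(congr1 (meval (fun=> 1))).
by rewrite mevalXU meval0.
Qed.

(** Clearing the denominator gives [x^4 + 1] in the square root [x] of the
    variable, which is not zero because its value at the origin is [1]. *)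
Lemma coord_norm_sqrt_x_neq0 (i : 'I_n) : coord_norm (@sqrt_x n) i != 0.
Proof.
rewrite (coord_norm_eq0 sqrt_x_neq0).
rewrite /sqrt_x -tofracXn -tofrac1 -tofracD tofrac_eq0.
apply/eqP => /(congr1 (meval (fun=> 0))).
by rewrite mevalD rmorphXn /= mevalXU meval1 meval0 expr0n addr0.
Qed.

End Substitution.

Theorem theorem3 (n : nat) (n_ge1 : (1 <= n)%N) :
  subst (\sum_(T in Tree (Q n)) q_dir T * x_dd T : cube_poly n)
  = (\prod_(i < n) fq i) *
    \prod_(A : {set 'I_n} | (2 <= #|A|)%N)
       \sum_(i in A) fq i * ((fx i)^-1 + fx i) :> root_frac n.
Proof.
rewrite subst_sum_trees cube_tree_sum //; first exact: sqrt_x_neq0.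
exact: coord_norm_sqrt_x_neq0.
Qed.
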